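(* Let $l\ge2$ and $q=1(l+1)l\ldots2$. For every integer $n\ge2$ the following hold, for indices $i$ with $1\le i$ and $i+1\le n-1$: (i) $c_{n,i}\le c_{n,i+1}$ for all $i<k_n$; (ii) $c_{n,i}\ge c_{n,i+1}$ for all $k_n\le i<l_n$; (iii) $c_{n,i}\le c_{n,i+1}$ for all $i\ge l_n$.
   Context: $q=1(l+1)l\ldots2$ is the permutation of length $l+1$ with first entry $1$ followed by $l+1,l,\ldots,2$. For $p\in S_j$, $c_q(p)$ counts subsequences of $p$ of length $l+1$ in the same relative order as $q$; $M_j=\max_{p\in S_j}c_q(p)$. For $1\le i\le n-1$ let $c_{n,i}=M_i+i\binom{n-i}{l}$. For $n\ge2$, $k_n$ is the largest $k\in\{1,\ldots,n-1\}$ maximizing $c_{n,k}$. $l_n$ is the least integer $i>k_n$ (with $i+1\le n-1$) such that $c_{n,i}\le c_{n,i+1}$; if there is no such integer, $l_n=n-1$. *)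

(* Defs.v *)
From mathcomp Require Import all_boot all_fingroup.

Set Implicit Arguments.
Unset Strict Implicit.
Unset Printing Implicit Defensive.

(* A permutation of length j is an element of 'S_j, so
   positions and values are numbered from 0 instead of 1; relative order is
   not affected. *)

Definition q_fun (l : nat) (i : 'I_l.+1) : 'I_l.+1 :=
  if i == ord0 then ord0 else inord (l.+1 - i).

Lemma q_fun_val (l : nat) (i : 'I_l.+1) :
  q_fun i = (if i == 0 :> nat then 0 else l.+1 - i) :> nat.
Proof.
rewrite /q_fun -val_eqE /=; case: i => [[|i]] //= lt_i.
by rewrite inordK // subSS ltnS leq_subr.
Qed.

Lemma q_fun_inj (l : nat) : injective (@q_fun l).
Proof.
apply: (can_inj (g := @q_fun l)) => i; apply: val_inj; rewrite /= !q_fun_val.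
case: i => [[|i]] //= lt_i.
by rewrite subn_eq0 leqNgt lt_i /= subKn // ltnW.
Qed.

(* In one-line notation (numbered from 1): 1 (l+1) l ... 2. *)
Definition q (l : nat) : 'S_l.+1 := perm (@q_fun_inj l).

(* A subsequence of p of length k is given by the strictly increasing map f
   listing its positions. *)
Definition is_occurrence (k j : nat) (s : 'S_k) (p : 'S_j)
    (f : {ffun 'I_k -> 'I_j}) : bool :=
  [forall a : 'I_k, forall b : 'I_k, (a < b) ==> (f a < f b)]
  && [forall a : 'I_k, forall b : 'I_k, (p (f a) < p (f b)) == (s a < s b)].

Definition pattern_count (k j : nat) (s : 'S_k) (p : 'S_j) : nat :=
  #|[set f : {ffun 'I_k -> 'I_j} | is_occurrence s p f]|.

Definition M (l j : nat) : nat := \max_(p : 'S_j) pattern_count (q l) p.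

Definition c (l n i : nat) : nat := M l i + i * 'C(n - i, l).

Definition maximizes (l n k : nat) : bool :=
  all (fun j => c l n j <= c l n k) (index_iota 1 n).

Definition kn (l n : nat) : nat := \max_(1 <= k < n | maximizes l n k) k.

(* The indices searched are those with kn l n < i and i + 1 <= n - 1, in
   increasing order; n - 1 is the default when there is none. *)
Definition ln (l n : nat) : nat :=
  head n.-1 [seq i <- index_iota (kn l n).+1 n.-1 | c l n i <= c l n i.+1].

(* Main.v *)
Require Import Defs.
From mathcomp Require Import all_boot all_fingroup.
From mathcomp Require Import zify.

(** An occurrence of q in p is a pair (x, A) where A is an l-element antichain
lying above x in the order "smaller position and smaller value".  For two
incomparable elements y and z, replacing y by a clone of z changes the number
of occurrences by at least f(z) - f(y), where f counts the occurrences
through an element; repeating this around a maximal element z makes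
everything outside the clones of z lie below them, whence
M_n = max_(k < n) (M_k + k C(n - k, l)).

This recursion makes M convex, since a maximizer k for n can be used for n - 1
and n + 1.  Put t = n - 1 - i; then c_(n,i+1) >= c_(n,i) reads
M_(i+1) - M_i + C(t, l) >= i C(t, l-1).  If 2t <= (l-1)(i+2), convexity
propagates this inequality from i to i + 1.  Otherwise it forces
t >= (l-1)i + l, and then it propagates from i + 1 to i, thanks to
M_(i+2) - 2 M_(i+1) + M_i <= C(i, l-1).  So the indices of strict descent
form an interval.  The last bound is proved by induction, together with the
existence of maximizers m_n of c_(n,.) (not always the largest) with
l m_n <= n and m_n <= m_(n+1) <= m_n + 1. *)

Set Implicit Arguments.
Unset Strict Implicit.
Unset Printing Implicit Defensive.

(** * Symmetrization in finite strict orders *)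

Section Occurrences.
Variables (T : finType) (l : nat).
Implicit Types (R : rel T) (D A : {set T}) (x y z : T).

Definition occ R D : {set T * {set T}} :=
  [set xA : T * {set T} | [&& xA.1 \in D, xA.2 \subset D, #|xA.2| == l,
     [forall a in xA.2, R xA.1 a]
   & [forall a in xA.2, forall b in xA.2, ~~ R a b]]].

Definition touching y : {set T * {set T}} :=
  [set xA : T * {set T} | (y == xA.1) || (y \in xA.2)].

Definition redirect y z x := if x == y then z else x.

(** The pullback of [R] along the map moving [y] to [z]: [y] becomes a second copy of [z], and
    irreflexivity and transitivity are inherited. *)
Definition clone R y z : rel T := relpre (redirect y z) R.

Lemma occP R D x A :
  reflect [/\ x \in D, A \subset D, #|A| = l, {in A, forall a, R x a}
            & {in A &, forall a b, ~~ R a b}] ((x, A) \in occ R D).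
Proof.
rewrite inE /=; apply: (iffP and5P).
  case=> xD AD /eqP cA /forall_inP xA /forall_inP AA; split=> // a b aA bA.
  by move/forall_inP: (AA a aA) => /(_ b bA).
case=> xD AD cA xA AA; split=> //; first exact/eqP.
  exact/forall_inP.
by apply/forall_inP => a aA; apply/forall_inP => b bA; apply: AA.
Qed.

Lemma redirect_tperm y z x : redirect y z (tperm y z x) = redirect y z x.
Proof.
rewrite /redirect; case: tpermP => [->|->|/eqP/negPf -> //].
  by rewrite eqxx if_same.
by rewrite eqxx if_same.
Qed.

(** Occurrences avoiding [y] survive the cloning. So do those through [z], and swapping [y] and [z]
    turns these into occurrences through [y], hence disjoint from the first kind. *)
Lemma occ_clone R D y z :
  y != z -> y \in D -> z \in D -> ~~ R y z -> ~~ R z y ->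
  #|occ R D :\: touching y| + #|occ R D :&: touching z|
    <= #|occ (clone R y z) D|.
Proof.
move=> neq_yz yD zD nyz nzy.
have keep x A : (x, A) \in occ R D ->
    ((x, A) \in touching y -> (x, A) \in touching z) ->
    (x, A) \in occ (clone R y z) D.
  case/occP=> xD AD cA xA AA yz; rewrite !inE /= in yz.
  have xy : redirect y z x = x.
    rewrite /redirect; case: eqP => // exy; move: yz.
    rewrite exy eqxx (eq_sym z) (negPf neq_yz) /= => /(_ isT) zA.
    by move: (xA z zA); rewrite exy (negPf nyz).
  have gA a : a \in A -> redirect y z a \in A.
    rewrite /redirect; case: eqP => // -> yA.
    move: yz; rewrite yA orbT => /(_ isT) /orP[/eqP zx|//].
    by move: (xA y yA); rewrite -zx (negPf nzy).
  apply/occP; split=> // [a aA|a b aA bA].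
    by rewrite /clone /= xy xA ?gA.
  by rewrite /clone /= AA ?gA.
pose tau (xA : T * {set T}) := (tperm y z xA.1, tperm y z @: xA.2).
have tau_inj : injective tau.
  move=> [x A] [x' A'] [/perm_inj -> eqA]; congr (_, _).
  exact: (imset_inj (@perm_inj _ _) eqA).
rewrite -(card_imset (mem (occ R D :&: touching z)) tau_inj) -cardsUI.
rewrite [X in _ + #|pred_of_set X|](_ : _ = set0) ?cards0 ?addn0; last first.
  apply/setP=> -[x A]; rewrite [RHS]inE; apply/negbTE/negP => /setIP[].
  case/setDP=> _ ny /imsetP[[x' A'] /setIP[_ zA]] [ex eA].
  move/negP: ny; apply; move: zA; rewrite !inE /= ex eA.
  case/orP=> [/eqP <-|zA]; first by rewrite tpermR eqxx.
  by apply/orP; right; apply/imsetP; exists z; rewrite ?tpermR.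
apply: subset_leq_card; apply/subsetP => -[x A] /setUP[/setDP[oxA /negPf ny]|].
  by apply: keep => //; rewrite ny.
case/imsetP=> -[x' A'] /setIP[oxA zA] [-> ->].
have /occP[xD AD cA xA AA] := keep _ _ oxA (fun _ => zA).
have tD a : a \in D -> tperm y z a \in D by case: tpermP => // ->.
apply/occP; split; first exact: tD.
- by apply/subsetP => _ /imsetP[a aA ->]; apply/tD/(subsetP AD).
- by rewrite card_imset //; apply: perm_inj.
- by move=> _ /imsetP[a aA ->]; rewrite /clone /= !redirect_tperm; apply: xA.
move=> _ _ /imsetP[a aA ->] /imsetP[b bA ->].
by rewrite /clone /= !redirect_tperm; apply: AA.
Qed.

(** An element with the most elements of [D] below it is maximal. *)
Lemma exists_maximal R D : irreflexive R -> transitive R -> D != set0 ->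
  exists2 z, z \in D & {in D, forall u, ~~ R z u}.
Proof.
move=> irr tr /set0Pn[z0 z0D].
pose below z := #|[set u in D | R u z]|.
have [z zD zmax] : exists2 z, z \in D & {in D, forall u, below u <= below z}.
  by case: (arg_maxnP below z0D) => z zD zmax; exists z.
exists z => // u uD; apply/negP=> zu.
have: below u <= below z := zmax u uD; rewrite /below leqNgt.
move/negP; apply; apply: proper_card.
apply/properP; split; last by exists z; rewrite inE zD ?zu ?irr.
by apply/subsetP=> w; rewrite !inE => /andP[-> /= wz]; apply: tr zu.
Qed.

Definition twins R D z : {set T} :=
  [set w in D | [forall u in D, (R u w == R u z) && (R w u == R z u)]].

Lemma twinsP R D z w :
  reflect (w \in D /\ {in D, forall u, R u w = R u z /\ R w u = R z u})
          (w \in twins R D z).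
Proof.
rewrite inE; apply: (iffP andP) => -[wD H]; split=> //.
  move=> u uD; by move/forall_inP: H => /(_ u uD) /andP[/eqP-> /eqP->].
by apply/forall_inP=> u uD; case: (H u uD) => -> ->; rewrite !eqxx.
Qed.

(** Twins of a maximal element are maximal, so the bottom of an occurrence is not a twin. If the
    antichain contains a twin [w], it consists of twins, since every other element of [D] lies below
    [w]. *)
Lemma occ_twins_top R D z : 0 < l -> z \in D -> {in D, forall u, ~~ R z u} ->
  {in D :\: twins R D z, forall u, R u z} ->
  #|occ R D| <= #|occ R (D :\: twins R D z)|
    + #|D :\: twins R D z| * 'C(#|twins R D z|, l).
Proof.
move=> l_gt0 zD zmax below; set C := twins R D z; set B := D :\: C.
rewrite -cards_draws -cardsX.
apply: leq_trans (leq_card_setU _ _); apply: subset_leq_card.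
apply/subsetP=> -[x A] oxA; have /occP[xD AD cA xA AA] := oxA.
have /set0Pn[a0 a0A] : A != set0 by rewrite -card_gt0 cA.
have xB : x \in B.
  rewrite inE xD andbT; apply/negP => /twinsP[_ /(_ a0 (subsetP AD _ a0A))].
  by case=> _; rewrite xA // (negPf (zmax _ (subsetP AD _ a0A))).
rewrite in_setU; have [dAC|/pred0Pn[w /andP[/= wA /twinsP[wD wz]]]] :=
  boolP [disjoint A & C]; apply/orP; [left|right].
  apply/occP; split=> //; apply/subsetP => a aA.
  by rewrite inE (subsetP AD) ?andbT // (disjointFr dAC).
rewrite inE xB !inE /= cA eqxx andbT; apply/subsetP=> a aA.
apply/negPn/negP => naC; have aD := subsetP AD _ aA.
have /below Raz : a \in B by rewrite inE naC.
by move: (AA a w aA wA); rewrite (wz a aD).1 Raz.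
Qed.

Lemma occ_exchange R D :
  0 < l -> irreflexive R -> transitive R -> D != set0 ->
  exists R' : rel T, exists D' : {set T},
    [/\ irreflexive R', transitive R', #|D'| < #|D|
      & #|occ R D| <= #|occ R' D'| + #|D'| * 'C(#|D| - #|D'|, l)].
Proof.
move=> l_gt0 irr tr D0.
(* Relations are coded as finite functions, so that pairs of an order and a maximal element range
   over a finite type and a weight can be maximized. *)
pose rl (r : {ffun T * T -> bool}) : rel T := fun a b => r (a, b).
pose fr (S : rel T) : {ffun T * T -> bool} := [ffun ab => S ab.1 ab.2].
have frK S : rl (fr S) =2 S by move=> a b; rewrite /rl ffunE.
have occ_eq S S' : S =2 S' -> occ S D = occ S' D.
  move=> eS; apply/setP=> -[x A].
  apply/occP/occP => -[xD AD cA xA AA]; split=> //.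
  - by move=> a aA; rewrite -eS xA.
  - by move=> a b aA bA; rewrite -eS AA.
  - by move=> a aA; rewrite eS xA.
  - by move=> a b aA bA; rewrite eS AA.
have tw_eq S S' z : S =2 S' -> twins S D z = twins S' D z.
  move=> eS; apply/setP=> w.
  apply/twinsP/twinsP => -[wD H]; split=> // u uD.
    by rewrite -!eS; apply: H.
  by rewrite !eS; apply: H.
pose good (rz : {ffun T * T -> bool} * T) : bool :=
  [&& [forall a, ~~ rl rz.1 a a],
      [forall b, forall a, forall d, rl rz.1 a b ==> rl rz.1 b d ==> rl rz.1 a d],
      rz.2 \in D & [forall u in D, ~~ rl rz.1 rz.2 u]].
have goodP S z : reflect [/\ irreflexive S, transitive S, z \in D
    & {in D, forall u, ~~ S z u}] (good (fr S, z)).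
  apply: (iffP and4P) => /= [[H1 H2 H3 H4]|[H1 H2 H3 H4]]; split=> //.
  - by move=> a; have := forallP H1 a; rewrite frK => /negPf.
  - move=> b a d; have /forallP/(_ a)/forallP/(_ d) := forallP H2 b.
    by rewrite !frK => /implyP H /H /implyP.
  - by move=> u uD; have := forall_inP H4 u uD; rewrite frK.
  - by apply/forallP=> a; rewrite frK H1.
  - apply/forallP=> b; apply/forallP=> a; apply/forallP=> d; rewrite !frK.
    by apply/implyP=> ab; apply/implyP; apply: H2 ab.
  - by apply/forall_inP=> u uD; rewrite frK H4.
(* The second summand is at most #|T|, so [weight] is a lexicographic order:
   first the number of occurrences, then the number of twins of z. *)
pose weight (rz : {ffun T * T -> bool} * T) :=
  #|occ (rl rz.1) D| * #|T|.+1 + #|twins (rl rz.1) D rz.2|.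
have wE S z : weight (fr S, z) = #|occ S D| * #|T|.+1 + #|twins S D z|.
  by rewrite /weight /= (occ_eq _ _ (frK S)) (tw_eq _ _ _ (frK S)).
have frlK r : fr (rl r) = r by apply/ffunP=> -[a b]; rewrite ffunE.
have [z0 z0D z0max] := exists_maximal irr tr D0.
have good0 : good (fr R, z0) by apply/goodP.
case: (arg_maxnP weight good0) => -[r z]; rewrite -(frlK r).
move: (rl r) => S /goodP[irrS trS zD zmax] wmax0 {r}.
have wmax rz : good rz -> weight rz <= weight (fr S, z) := wmax0 rz.
have le_occ : #|occ R D| <= #|occ S D|.
  have := wmax _ good0; rewrite !wE => H.
  rewrite -ltnS -(ltn_pmul2r (ltn0Sn #|T|)); rewrite mulSn.
  apply: leq_ltn_trans (leq_trans (leq_addr _ _) H) _.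
  by rewrite addnC ltn_add2r ltnS max_card.
have below : {in D :\: twins S D z, forall u, S u z}.
  move=> y /setDP[yD yC]; apply/negPn/negP=> nyz.
  have nzy := zmax y yD.
  have neq_yz : y != z.
    by apply: contraNneq yC => ->; apply/twinsP.
  have touchE u : #|occ S D| = #|occ S D :\: touching u| + #|occ S D :&: touching u|.
    by rewrite -(cardsID (touching u) (occ S D)) addnC.
  (* If more occurrences pass through [y], turning [z] into a clone of [y] increases the count.
     Otherwise turning [y] into a clone of [z] does not lower the count and adds [y] to the twins of
     [z]. Both contradict maximality. *)
  have [lt_f|le_f] := ltnP #|occ S D :&: touching z| #|occ S D :&: touching y|.
    pose S' := clone S z y.
    have irrS' : irreflexive S' by move=> a; apply: irrS.
    have trS' : transitive S' by move=> a b d; apply: trS.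
    have [z' z'D z'max] := exists_maximal irrS' trS' D0.
    have /wmax : good (fr S', z') by apply/goodP.
    rewrite !wE leqNgt => /negP; apply.
    have lt_occ : #|occ S D| < #|occ S' D|.
      have := @occ_clone S D z y; rewrite eq_sym => /(_ neq_yz zD yD nzy nyz).
      by apply: leq_trans; rewrite (touchE z) ltn_add2l.
    have : #|occ S D| * #|T|.+1 + #|T|.+1 <= #|occ S' D| * #|T|.+1.
      by rewrite addnC -mulSn leq_mul2r lt_occ.
    move=> H; apply: leq_trans (leq_trans H (leq_addr _ _)).
    by rewrite -addnS leq_add2l ltnS max_card.
  pose S' := clone S y z.
  have rdz : redirect y z z = z by rewrite /redirect if_same.
  have rdD u : u \in D -> redirect y z u \in D.
    by rewrite /redirect; case: eqP.
  have /wmax : good (fr S', z).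
    apply/goodP; split=> //.
    - by move=> a; apply: irrS.
    - by move=> a b d; apply: trS.
    - by move=> u uD; rewrite /S' /clone /= rdz zmax ?rdD.
  rewrite !wE leqNgt => /negP; apply.
  have le_occ' : #|occ S D| <= #|occ S' D|.
    have := @occ_clone S D y z neq_yz yD zD nyz nzy.
    by apply: leq_trans; rewrite {1}(touchE y) leq_add2l.
  rewrite -addnS; apply: leq_add; first by rewrite leq_mul2r le_occ' orbT.
  apply: proper_card; apply/properP; split; last first.
    exists y => //; apply/twinsP; split=> // u uD.
    by rewrite /S' /clone /= rdz /redirect eqxx.
  apply/subsetP => w wC; have /twinsP[wD wz] := wC.
  apply/twinsP; split=> // u uD.
  have -> : S' u w = S (redirect y z u) w.
    rewrite /S' /clone /= {2}/redirect; case: eqP => // ewy.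
    by rewrite -ewy wC in yC.
  have -> : S' w u = S w (redirect y z u).
    rewrite /S' /clone /= {1}/redirect; case: eqP => // ewy.
    by rewrite -ewy wC in yC.
  by rewrite /S' /clone /= rdz; apply/wz/rdD.
have zC : z \in twins S D z by apply/twinsP.
have sCD : twins S D z \subset D by apply/subsetP => w /twinsP[].
exists S, (D :\: twins S D z); split=> //.
  apply: proper_card; apply/properP; split; first exact: subsetDl.
  by exists z => //; rewrite inE zC.
apply: leq_trans le_occ _; apply: leq_trans (occ_twins_top l_gt0 zD zmax below) _.
rewrite leq_add2l leq_mul2l cardsDS // subKn ?leqnn ?orbT //.
exact: subset_leq_card.
Qed.

End Occurrences.

(** * The recursion for M *)

Definition below (j : nat) (p : 'S_j) : rel 'I_j :=
  fun x y => (x < y) && (p x < p y).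

Lemma below_irr j (p : 'S_j) : irreflexive (below p).
Proof. by move=> x; rewrite /below ltnn. Qed.

Lemma below_trans j (p : 'S_j) : transitive (below p).
Proof.
move=> y x z /andP[xy pxy] /andP[yz pyz].
by rewrite /below (ltn_trans xy) ?(ltn_trans pxy).
Qed.

Lemma occurrenceP k j (s : 'S_k) (p : 'S_j) (f : {ffun 'I_k -> 'I_j}) :
  reflect ((forall a b : 'I_k, a < b -> f a < f b) /\
           (forall a b : 'I_k, (p (f a) < p (f b)) = (s a < s b)))
          (is_occurrence s p f).
Proof.
apply: (iffP andP) => -[H1 H2]; split.
- by move=> a b; have /forallP/(_ b)/implyP := forallP H1 a.
- by move=> a b; have /forallP/(_ b)/eqP := forallP H2 a.
- by apply/forallP=> a; apply/forallP=> b; apply/implyP; apply: H1.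
- by apply/forallP=> a; apply/forallP=> b; rewrite H2.
Qed.

Lemma increasing_inj k j (f : 'I_k -> 'I_j) :
  (forall a b : 'I_k, a < b -> f a < f b) -> injective f.
Proof.
move=> inc a b eq_f; apply: val_inj; case: (ltngtP a b) => // /inc.
  by rewrite eq_f ltnn.
by rewrite eq_f ltnn.
Qed.

Lemma increasing_eq_codom k j (f g : {ffun 'I_k -> 'I_j}) :
  (forall a b : 'I_k, a < b -> f a < f b) -> (forall a b : 'I_k, a < b -> g a < g b) ->
  codom f =i codom g -> f = g.
Proof.
move=> incf incg eq_fg; pose ltj (x y : 'I_j) := x < y.
have srt (h : {ffun 'I_k -> 'I_j}) :
    (forall a b : 'I_k, a < b -> h a < h b) -> sorted ltj (codom h).
  move=> inch; rewrite codomE.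
  apply: (homo_sorted (e := relpre val ltn)); first exact: inch.
  by rewrite -sorted_map val_enum_ord iota_ltn_sorted.
have eqc : codom f = codom g.
  apply: (@irr_sorted_eq _ ltj) => //; rewrite ?srt //.
  - by move=> y x z; apply: ltn_trans.
  - by move=> x; rewrite /ltj ltnn.
apply/ffunP=> a; move: eqc; rewrite !codomE => /eq_in_map; apply.
by rewrite mem_enum.
Qed.

Lemma q_lt l (a b : 'I_l.+1) :
  (q l a < q l b) = (if a == 0 :> nat then b != 0 :> nat else (b != 0 :> nat) && (b < a)).
Proof.
rewrite !permE !q_fun_val; case: a b => [[|a] lta] [[|b] ltb] //=.
  by rewrite subn_gt0.
by rewrite ltn_sub2lE // ltnW.
Qed.

(** An occurrence is determined by its first position and the set of the others, as an increasing
    map is determined by its image. The entries after the first decrease, so their positions form an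
    antichain. *)
Lemma pattern_count_le_occ l j (p : 'S_j) :
  pattern_count (q l) p <= #|occ l (below p) [set: 'I_j]|.
Proof.
pose F (f : {ffun 'I_l.+1 -> 'I_j}) := (f ord0, f @: [set~ ord0]).
rewrite /pattern_count -(@card_in_imset _ _ F); last first.
  move=> f g; rewrite !inE => /occurrenceP[incf _] /occurrenceP[incg _] [e0 e1].
  apply: increasing_eq_codom => // x.
  have cod (h : {ffun 'I_l.+1 -> 'I_j}) :
      (x \in codom h) = (x == h ord0) || (x \in h @: [set~ ord0]).
    apply/codomP/orP => [[a ->]|[/eqP->|/imsetP[a _ ->]]]; last 2 first.
    - by exists ord0.
    - by exists a.
    case: (eqVneq a ord0) => [->|a0]; [by left | right].
    by apply: imset_f; rewrite !inE.
  by rewrite !cod e0 e1.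
apply: subset_leq_card; apply/subsetP => _ /imsetP[f + ->].
rewrite inE => /occurrenceP[incf pf]; have injf := increasing_inj incf.
apply/occP; split; rewrite ?subsetT //.
- by rewrite card_imset // cardsC1 card_ord.
- move=> _ /imsetP[a a0 ->]; rewrite !inE -val_eqE /= -lt0n in a0.
  by rewrite /below incf // pf q_lt /= -lt0n.
move=> _ _ /imsetP[a a0 ->] /imsetP[b b0 ->].
rewrite !inE -!val_eqE /= in a0 b0.
rewrite /below pf q_lt (negPf a0) b0 /=; apply/negP=> /andP[lt_f lt_ba].
by move: (incf _ _ lt_ba); rewrite ltnNge ltnW.
Qed.

(** The direct sum of [p] and the decreasing permutation of length [m]. *)
Definition dsum_fun k m (p : 'S_k) (i : 'I_(k + m)) : 'I_(k + m) :=
  unsplit (match split i with inl a => inl (p a) | inr b => inr (rev_ord b) end).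

Lemma dsum_inj k m (p : 'S_k) : injective (@dsum_fun k m p).
Proof.
move=> i j /(can_inj (@unsplitK k m)); rewrite -{2}(splitK i) -{2}(splitK j).
case: (split i) (split j) => [a|a] [b|b] // [].
  by move/perm_inj->.
by move=> e; congr (unsplit (inr _)); apply/rev_ord_inj/val_inj.
Qed.

Definition dsum k m (p : 'S_k) : 'S_(k + m) := perm (@dsum_inj k m p).

Lemma dsum_lshift k m (p : 'S_k) a : dsum m p (lshift m a) = lshift m (p a).
Proof. by rewrite permE /dsum_fun (unsplitK (inl a)). Qed.

Lemma dsum_rshift k m (p : 'S_k) b : dsum m p (rshift k b) = rshift k (rev_ord b).
Proof. by rewrite permE /dsum_fun (unsplitK (inr b)). Qed.

(** [F] keeps the occurrences inside [p]; [G] takes the first entry from [p] and the other [l] from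
    the decreasing block. The block of the second entry tells them apart. *)
Lemma pattern_count_dsum l k m (p : 'S_k) : 0 < l ->
  pattern_count (q l) p + k * 'C(m, l) <= pattern_count (q l) (dsum m p).
Proof.
move=> l0.
pose F (f : {ffun 'I_l.+1 -> 'I_k}) : {ffun 'I_l.+1 -> 'I_(k + m)} :=
  [ffun i => lshift m (f i)].
pose G (xt : 'I_k * l.-tuple 'I_m) : {ffun 'I_l.+1 -> 'I_(k + m)} :=
  [ffun i => if unlift ord0 i is Some i' then rshift k (tnth xt.2 i')
             else lshift m xt.1].
have F_inj : injective F.
  move=> f g /ffunP eqF; apply/ffunP => i; have := eqF i.
  by rewrite !ffunE => /lshift_inj.
have G_inj : injective G.
  move=> [a t] [b u] /ffunP eqG.
  have := eqG ord0; rewrite !ffunE unlift_none /= => /lshift_inj ->.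
  congr (_, _); apply: eq_from_tnth => i; have := eqG (lift ord0 i).
  by rewrite !ffunE liftK /= => /rshift_inj.
pose incs := [set t : l.-tuple 'I_m | sorted ltn [seq val i | i <- t]].
rewrite /pattern_count -card_ltn_sorted_tuples -/incs -[k in k * _]card_ord.
rewrite -cardsT -cardsX -(card_imset _ F_inj) -(card_imset _ G_inj) -cardsUI.
rewrite [X in _ + #|pred_of_set X|](_ : _ = set0) ?cards0 ?addn0; last first.
  apply/setP=> h; rewrite [RHS]inE; apply/negbTE/negP => /setIP[].
  case/imsetP=> f _ -> /imsetP[[a t] _] /ffunP.
  move/(_ (lift ord0 (Ordinal l0))); rewrite !ffunE liftK => /eqP.
  by rewrite eq_lrshift.
apply: subset_leq_card; apply/subsetP => h /setUP[] /imsetP[].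
  move=> f; rewrite !inE => /occurrenceP[incf pf] ->.
  apply/occurrenceP; split=> a b; first by rewrite !ffunE /=; apply: incf.
  by rewrite !ffunE !dsum_lshift /= pf.
case=> x t; rewrite !inE /= => srt ->.
have inct (i j : 'I_l) : i < j -> tnth t i < tnth t j.
  move=> ij; have x0 : 'I_m := tnth t i; rewrite !(tnth_nth x0).
  have := sorted_ltn_nth ltn_trans 0 srt.
  move/(_ i j); rewrite !inE !size_map size_tuple => /(_ (ltn_ord i) (ltn_ord j) ij).
  by rewrite !(nth_map x0) ?size_tuple.
have inct' (i j : 'I_l) : (tnth t i < tnth t j) = (i < j).
  apply/idP/idP; last exact: inct.
  apply: contraTltn; rewrite -leqNgt leq_eqVlt => /predU1P[/val_inj ->|/inct] //.
  exact: ltnW.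
apply/occurrenceP; split=> a b; rewrite !ffunE.
  case: (unliftP ord0 a) => [a'|] ->; case: (unliftP ord0 b) => [b'|] -> //=.
    by rewrite ltn_add2l inct'.
  by move=> _; apply: leq_trans (ltn_ord x) (leq_addr _ _).
rewrite q_lt; case: (unliftP ord0 a) => [a'|] ->; case: (unliftP ord0 b) => [b'|] -> //=.
- by rewrite !dsum_rshift /= ltn_add2l ltn_sub2lE ?ltnS ?ltn_ord // inct'.
- by rewrite dsum_rshift dsum_lshift /= ltnNge ltnW // ltn_addr.
- by rewrite dsum_rshift dsum_lshift /= ltn_addr.
- by rewrite ltnn.
Qed.

Lemma M_ge_dsum l n k : 0 < l -> k <= n -> M l k + k * 'C(n - k, l) <= M l n.
Proof.
move=> l0 /subnKC; set m := n - k; clearbody m => <- {n}.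
have : 0 < #|{: 'S_k}| by apply/card_gt0P; exists 1%g.
case/(eq_bigmax (fun p : 'S_k => pattern_count (q l) p)) => p ep.
rewrite /M ep; apply: leq_trans (pattern_count_dsum _ _ _) (leq_bigmax _) => //.
Qed.

(** Cloning takes place among all strict orders; this leads back to permutations. By induction on
    the size, the order left by an exchange is bounded by [M], and a direct sum accounts for the
    added term. *)
Lemma occ_le_M (T : finType) l (R : rel T) (D : {set T}) : 0 < l ->
  irreflexive R -> transitive R -> #|occ l R D| <= M l #|D|.
Proof.
move=> l0; move: {2}#|D|.+1 (ltnSn #|D|) => N.
elim: N R D => // N IH R D leN irr tr.
have [D0|D0] := eqVneq D set0.
  rewrite (_ : occ l R D = set0) ?cards0 //; apply/setP=> -[x A].
  by rewrite [RHS]inE; apply/negP=> /occP[]; rewrite D0 inE.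
have [R' [D' [irr' tr' ltD le]]] := occ_exchange l0 irr tr D0.
apply: leq_trans le (leq_trans _ (M_ge_dsum l0 (ltnW ltD))).
by rewrite leq_add2r IH // (leq_trans ltD).
Qed.

Lemma M_le_dsum l n : 0 < l -> 0 < n ->
  exists2 k, k < n & M l n <= M l k + k * 'C(n - k, l).
Proof.
move=> l0 n0.
have : 0 < #|{: 'S_n}| by apply/card_gt0P; exists 1%g.
case/(eq_bigmax (fun p : 'S_n => pattern_count (q l) p)) => p ep.
have D0 : [set: 'I_n] != set0 by rewrite -card_gt0 cardsT card_ord.
have [R [D]] := occ_exchange l0 (below_irr p) (@below_trans _ p) D0.
rewrite cardsT card_ord => -[irr tr ltD le]; exists #|D| => //.
rewrite {1}/M ep; apply: leq_trans (pattern_count_le_occ _ _) (leq_trans le _).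
by rewrite leq_add2r occ_le_M.
Qed.

Lemma M_0 l : M l 0 = 0.
Proof.
apply/eqP; rewrite -leqn0; apply/bigmax_leqP => p _.
rewrite leqn0 cards_eq0; apply/eqP/setP => f.
by case: (f ord0).
Qed.

(** * Differences of [M] and propagation of rises *)

Section Differences.
Variable p : nat.

(* [cc i t] is [c l (i + t) i] with [l = p.+2], free of truncated subtraction. *)
Definition cc i t := M p.+2 i + i * 'C(t, p.+2).

Lemma c_cc n i : i <= n -> c p.+2 n i = cc i (n - i).
Proof. by []. Qed.

Lemma cc_le_M i t : cc i t <= M p.+2 (i + t).
Proof. by have := @M_ge_dsum p.+2 (i + t) i isT (leq_addr _ _); rewrite addKn. Qed.

Lemma M_small n : n <= p.+2 -> M p.+2 n = 0.
Proof.
elim/ltn_ind: n => -[|n] IH len; first exact: M_0.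
have [k ltk] := @M_le_dsum p.+2 n.+1 isT isT.
rewrite (IH k) //; last by lia.
case: k ltk => [|k] ltk; first by rewrite mul0n leqn0 => /eqP.
by rewrite bin_small ?muln0 ?leqn0 => [/eqP|]; lia.
Qed.

Lemma M_split n : 2 <= n ->
  exists k t, [/\ 0 < k, 0 < t, k + t = n & M p.+2 n = cc k t].
Proof.
move=> n2; have [k ltk leM] := @M_le_dsum p.+2 n isT (ltnW n2).
have [k0|k0] := posnP k.
  (* For [k = 0] the bound gives [M p.+2 n = 0], so any split attains it. *)
  exists 1, n.-1; split; try lia.
  have := cc_le_M 1 n.-1; rewrite (_ : 1 + n.-1 = n); last by lia.
  by move: leM; rewrite k0 M_0; lia.
exists k, (n - k); split; try lia.
have := cc_le_M k (n - k); rewrite (_ : k + (n - k) = n) /cc; lia.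
Qed.

(** An optimal [k] for the middle index is used at both neighbours; the second difference of
    ['C(t, p.+2)] in [t] is nonnegative. *)
Lemma M_convex i : 2 * M p.+2 i.+1 <= M p.+2 i.+2 + M p.+2 i.
Proof.
case: i => [|i]; first by rewrite !M_small.
have [k [t [_ t0 e ->]]] := @M_split i.+2 isT; case: t t0 e => // t _ e.
have := cc_le_M k t; have := cc_le_M k t.+2.
rewrite (_ : k + t.+2 = i.+3) 1?(_ : k + t = i.+1); try lia.
by rewrite /cc !binS; nia.
Qed.

Lemma mul_bin_le k t r : k * 'C(t, r) <= 'C(k + t, r.+1).
Proof.
elim: k => [|k IH] //; rewrite mulSn addSn binS addnC leq_add //.
by rewrite leq_bin2l // leq_addl.
Qed.

Lemma M_step i : exists k t, k + t = i /\ M p.+2 i.+1 <= M p.+2 i + k * 'C(t, p.+1).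
Proof.
case: i => [|i]; first by exists 0, 0; rewrite !M_small.
have [k [t [_ t0 e ->]]] := @M_split i.+2 isT; case: t t0 e => // t _ e.
exists k, t; split; first by lia.
have := cc_le_M k t; rewrite (_ : k + t = i.+1); last by lia.
by rewrite /cc !binS; nia.
Qed.

Lemma M_step_bin i : M p.+2 i.+1 <= M p.+2 i + 'C(i, p.+2).
Proof.
have [k [t [<-]]] := M_step i => /leq_trans; apply.
by rewrite leq_add2l mul_bin_le.
Qed.

Lemma cc_rises i t :
  (cc i t.+1 <= cc i.+1 t) =
  (M p.+2 i + i * 'C(t, p.+1) <= M p.+2 i.+1 + 'C(t, p.+2)).
Proof. by rewrite /cc binS; apply/idP/idP; nia. Qed.

(* For l = 2 the bound M_(i+1) - M_i <= C(i, l) is too weak, and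
   M_(i+1) - M_i <= k r <= i^2 / 4 with k + r = i is used instead. *)
Lemma rise_gap i t : 0 < i -> p.+1 * i.+1 < 2 * t.+1 ->
  cc i t.+1 <= cc i.+1 t -> p.+1 * i + p.+2 <= t.
Proof.
move=> i0 left; rewrite cc_rises; apply: contraTT; rewrite -!ltnNge => small.
have := mul_bin_left t p.+1; set c1 := 'C(t, p.+1); set c2 := 'C(t, p.+2) => e2.
have [p0|p0] := posnP p.
  have [k [r []]] := M_step i.
  move: small left e2; rewrite /c1 p0 !bin1; subst c2; set c2 := 'C(t, _).
  move=> small left e2 e leM.
  have agm : 4 * (k * r) <= i * i by rewrite -e mulnn nat_AGM2.
  (* [a] and [b] are the slacks in [left] and [small]; [a * b >= 0] is the quadratic inequality that
     closes this case. *)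
  have [a ea] : exists a, 2 * t = i + a by exists (2 * t - i); lia.
  have [b eb] : exists b, i.+1 = t + b by exists (i.+1 - t); lia.
  have prod : a * b + 2 * (t * t) + i * i + i = 3 * (t * i) + 2 * t.
    have h1 := congr2 muln ea eb.
    have h2 := congr1 (muln i) eb; have h3 := congr1 (muln t) ea.
    by lia.
  have e3 : 2 * c2 + t = t * t by case: (t) e2 => [|t']; lia.
  have := leq0n (a * b); lia.
have leM := M_step_bin i.
have eB : p.+2 * 'C(i, p.+2) = i * 'C(i.-1, p.+1) by rewrite -mul_bin_diag.
have lt_c : 'C(i.-1, p.+1) < c1.
  apply: (@leq_trans 'C(t.-1, p.+1).+1).
    by rewrite ltnS leq_bin2l //; nia.
  rewrite /c1; case: (t) left => [|t'] left; first by nia.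
  by rewrite binS -addn1 leq_add2l bin_gt0; nia.
have le_c : (t - p.+1) * c1 <= (p.+1 * i) * c1.
  by rewrite leq_mul2r; apply/orP; right; lia.
have lt_ic : i * 'C(i.-1, p.+1) < i * c1 by rewrite ltn_pmul2l.
(* The first summand contributes less than [i * c1], the second at most [p.+1 * i * c1]. *)
have : p.+2 * ('C(i, p.+2) + c2) < p.+2 * (i * c1) by lia.
by rewrite ltn_pmul2l //; lia.
Qed.

(** By convexity it is enough that [2 * 'C(u, p.+1) <= i * 'C(u, p)], which follows from
    [2 * (u - p) <= p.+1 * i]; this is where the threshold comes from. *)
Lemma rise_right i u : 2 * u.+1 <= p.+1 * i.+2 ->
  cc i u.+2 <= cc i.+1 u.+1 -> cc i.+1 u.+1 <= cc i.+2 u.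
Proof.
rewrite !cc_rises !binS => right.
have := M_convex i; have := mul_bin_left u p.
have : 2 * ((u - p) * 'C(u, p)) <= p.+1 * i * 'C(u, p).
  by rewrite mulnA leq_mul2r; apply/orP; right; nia.
nia.
Qed.

Definition concave_bound i :=
  M p.+2 i.+2 + M p.+2 i <= 2 * M p.+2 i.+1 + 'C(i, p.+1).

(** It is enough that [i * 'C(u, p) + 'C(i, p.+1) <= 2 * 'C(u, p.+1)]; the lower bound on [u] from
    [rise_gap] makes the right side large enough. *)
Lemma rise_left i u : concave_bound i -> p.+1 * i.+2 < 2 * u.+1 ->
  cc i.+1 u.+1 <= cc i.+2 u -> cc i u.+2 <= cc i.+1 u.+1.
Proof.
move=> bnd left up; have gap := rise_gap (ltn0Sn i) left up.
move: up; rewrite !cc_rises !binS.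
have := mul_bin_left u p; have := mul_bin_left i p.
have : (i - p) * 'C(i, p) <= i * 'C(u, p).
  by rewrite leq_mul ?leq_subr // leq_bin2l //; nia.
have : (p.+1 * i.+1 * 2) * 'C(u, p) <= (2 * (u - p)) * 'C(u, p).
  by rewrite leq_mul2r; apply/orP; right; nia.
move: bnd; rewrite /concave_bound.
nia.
Qed.
End Differences.

(** * Low maximizers and the shape of the sequence *)

Section Chain.
Variable p : nat.

Lemma c_le_M n i : i <= n -> c p.+2 n i <= M p.+2 n.
Proof. by move=> len; rewrite -{2}(subnKC len) cc_le_M. Qed.

Lemma c_rise_cc n i : i < n ->
  (c p.+2 n i <= c p.+2 n i.+1) = (cc p i (n - i.+1).+1 <= cc p i.+1 (n - i.+1)).
Proof. by move=> lt_in; rewrite /c -subSn. Qed.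

Lemma c_rise_right n i j : 2 * (n - i.+1) <= p.+1 * i.+2 -> i <= j < n ->
  c p.+2 n i <= c p.+2 n i.+1 -> c p.+2 n j <= c p.+2 n j.+1.
Proof.
move=> right /andP[ij jn] up; elim: j ij jn => [|j IH] ij jn.
  by move: ij; rewrite leqn0 => /eqP <-.
have [<- //|ne] := eqVneq i j.+1.
have /IH/(_ (ltnW jn)) : i <= j by lia.
rewrite !c_rise_cc //; last by lia.
rewrite (_ : n - j.+1 = (n - j.+2).+1); last by lia.
apply: rise_right; nia.
Qed.

Lemma c_rise_left n i j : (forall i, concave_bound p i) ->
  p.+1 * j.+1 < 2 * (n - j) -> 0 < i <= j -> j < n ->
  c p.+2 n j <= c p.+2 n j.+1 -> c p.+2 n i <= c p.+2 n i.+1.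
Proof.
move=> bnd left /andP[i0 ij] jn up.
elim: j ij jn left up => [|j IH] ij jn left up; first by lia.
have [-> //|ne] := eqVneq i j.+1.
apply: IH; try nia.
move: up; rewrite !c_rise_cc //; last by lia.
rewrite (_ : n - j.+1 = (n - j.+2).+1); last by lia.
apply: rise_left => //; nia.
Qed.

Definition low_maximizer n k :=
  [/\ 0 < k, p.+2 * k <= n & M p.+2 n = c p.+2 n k].

(** [i * 'C(n - i, p.+1)] is the gain of [c p.+2 _ i] from [n] to [n.+1], so no index below [k]
    overtakes a low maximizer [k]. *)
Lemma weight_le n k i : p.+2 * k <= n -> i <= k ->
  i * 'C(n - i, p.+1) <= k * 'C(n - k, p.+1).
Proof.
move=> lkn; elim: k lkn => [|k IH] lkn; first by rewrite leqn0 => /eqP->.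
rewrite leq_eqVlt => /predU1P[-> //|ik].
apply: leq_trans (IH _ ik) _; first by nia.
rewrite (_ : n - k = (n - k.+1).+1) ?binS; last by nia.
set t := n - k.+1; have := mul_bin_left t p.
have : p.+1 * k * 'C(t, p) <= (t - p) * 'C(t, p).
  by rewrite leq_mul2r; apply/orP; right; rewrite /t; nia.
nia.
Qed.

(** The difference of [c p.+2 n.+1 j.+1] and [c p.+2 n j] does not increase with [j]: a step adds at
    most ['C(j, p.+1)] through [M] and removes ['C(n - j.+1, p.+1)]. *)
Lemma next_le n k j : (forall i, i.+2 <= n -> concave_bound p i) ->
  0 < k <= j -> p.+2 * j.+1 <= n ->
  c p.+2 n.+1 j.+1 + c p.+2 n k <= c p.+2 n.+1 k.+1 + c p.+2 n j.
Proof.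
move=> bnd /andP[k0]; elim: j => [|j IH]; first by lia.
rewrite leq_eqVlt => /predU1P[-> //|kj] ljn.
have := IH kj; have /bnd : j.+2 <= n by nia.
rewrite /concave_bound /c !subSS (_ : n - j = (n - j.+1).+1) ?binS; last by nia.
have : 'C(j, p.+1) <= 'C(n - j.+1, p.+1) by apply: leq_bin2l; nia.
set X := _ * 'C(n - k, _); set Y := _ * 'C(n - k, _).
nia.
Qed.

Lemma low_maximizer_next n k : (forall i, i.+2 <= n -> concave_bound p i) ->
  low_maximizer n k -> low_maximizer n.+1 k \/ low_maximizer n.+1 k.+1.
Proof.
move=> bnd [k0 lkn eM]; set X := maxn (c p.+2 n.+1 k) (c p.+2 n.+1 k.+1).
have ltkn : k < n by nia.
have leMX : M p.+2 n <= X.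
  rewrite eM; apply: leq_trans (leq_maxl _ _).
  by rewrite /c leq_add2l leq_mul2l leq_bin2l ?orbT //; lia.
have small i : 0 < i -> p.+2 * i <= n -> c p.+2 n.+1 i <= X.
  move=> i0 lin; have [lik|lki] := leqP i k.
    apply: leq_trans (leq_maxl _ _).
    have := weight_le lkn lik; have : c p.+2 n i <= c p.+2 n k.
      by rewrite -eM c_le_M //; nia.
    by rewrite /c !subSn ?binS; nia.
  apply: leq_trans (leq_maxr _ _).
  case: i i0 lki lin => // i _ ki lin.
  have := @next_le n k i bnd; rewrite k0 -ltnS ki => /(_ isT lin).
  have : c p.+2 n i <= c p.+2 n k by rewrite -eM c_le_M //; nia.
  lia.
have all_le i : 0 < i <= n -> c p.+2 n.+1 i <= X.
  elim: i => [|i IH] // /andP[_ ltin].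
  have [lin|lin] := leqP (p.+2 * i.+1) n; first exact: small.
  have i0 : 0 < i by case: (i) lin => //; nia.
  have [down|/ltnW up] := leqP (c p.+2 n.+1 i.+1) (c p.+2 n.+1 i).
    by apply: leq_trans down (IH _); lia.
  (* Otherwise [rise_gap] would give [p.+2 * i.+1 <= n]. *)
  have right : 2 * (n - i).+1 <= p.+1 * i.+1.
    rewrite leqNgt; apply/negP => left; move: up; rewrite c_rise_cc; last by lia.
    rewrite subSS => up; have := rise_gap i0 left up; nia.
  (* The rises continue up to index [n], where [c p.+2 n.+1 n = M p.+2 n]. *)
  have climb d : i.+1 + d <= n.+1 -> c p.+2 n.+1 i.+1 <= c p.+2 n.+1 (i.+1 + d).
    elim: d => [|d IHd] led; first by rewrite addn0.
    rewrite addnS; apply: leq_trans (IHd _) _; first by lia.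
    by apply: (@c_rise_right _ i) => //; lia.
  apply: leq_trans (climb (n - i.+1) _) _; first by lia.
  by rewrite subnKC // /c subSnn bin_small // muln0 addn0.
have [i [t [i0 t0 eit eMi]]] := @M_split p n.+1 ltac:(nia).
have leMX' : M p.+2 n.+1 <= X.
  have -> : M p.+2 n.+1 = c p.+2 n.+1 i.
    by rewrite eMi c_cc; [congr (cc _ _ _); lia | lia].
  by apply: all_le; lia.
have [le|lt] := leqP (c p.+2 n.+1 k.+1) (c p.+2 n.+1 k).
  left; split=> //; first by nia.
  apply/eqP; rewrite eqn_leq c_le_M ?andbT; last by lia.
  by move: leMX'; rewrite /X (maxn_idPl le).
right; split=> //.
  move: (ltnW lt); rewrite c_rise_cc ?subSS; last by lia.
  move/(rise_gap k0) => gap; have : p.+1 * k + p.+2 <= n - k by apply: gap; nia.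
  nia.
apply/eqP; rewrite eqn_leq c_le_M ?andbT; last by lia.
by move: leMX'; rewrite /X (maxn_idPr (ltnW lt)).
Qed.

(** [M p.+2 n.+1] is bounded below twice: by the split at [j] if [k = j], at [j.+1] if [k = j.+2],
    and once by each if [k = j.+1]. What remains is at most ['C(n, p.+1)], using the bound at [j]
    when [k = j.+2]. *)
Lemma concave_bound_low n j k : low_maximizer n j -> low_maximizer n.+2 k ->
  j <= k <= j.+2 -> concave_bound p j -> concave_bound p n.
Proof.
move=> [j0 ljn ej] [k0 lkn ek] jk bndj; rewrite /concave_bound ej ek.
have [t en] : exists t, n = j + t by exists (n - j); nia.
rewrite {}en in ljn *.
have := @cc_le_M p j t.+1; have := @cc_le_M p j.+1 t.
rewrite addSn addnS => leM1 leM0; rewrite !c_cc; try lia.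
have {jk} [->|[->|->]] : k = j \/ k = j.+1 \/ k = j.+2 by lia.
- rewrite addKn (_ : _ - j = t.+2); last by lia.
  have := mul_bin_le j t p; move: leM0; rewrite /cc !binS; nia.
- rewrite addKn (_ : _ - j.+1 = t.+1); last by lia.
  have : 'C(t, p.+1) <= 'C(j + t, p.+1) by rewrite leq_bin2l // leq_addl.
  by move: leM0 leM1; rewrite /cc !binS; nia.
rewrite addKn (_ : _ - j.+2 = t); last by lia.
have : 'C(j, p.+1) <= 'C(j + t, p.+1) by rewrite leq_bin2l // leq_addr.
by move: bndj leM1; rewrite /concave_bound /cc; nia.
Qed.

(** A joint induction: the bounds so far carry a low maximizer to the next index, and the low
    maximizers of [n] and [n.+2] give the bound at [n]. *)
Lemma low_maximizers n : p.+2 <= n ->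
  (forall i, i.+2 <= n.+1 -> concave_bound p i) /\
  exists j k, [/\ low_maximizer n j, low_maximizer n.+1 k & j <= k <= j.+1].
Proof.
have small i : i <= p -> concave_bound p i.
  by move=> ip; rewrite /concave_bound !M_small //; lia.
elim: n => // n IH; rewrite leq_eqVlt => /predU1P[<-|ln].
  have low1 : low_maximizer p.+2 1.
    split; rewrite ?muln1 // M_small // /c M_small // subn1 /= mul1n bin_small //.
  (* The alternative 2 is excluded because [p.+2 * 2 > p.+3]. *)
  have lown : low_maximizer p.+3 1.
    have [i|//|[_ bad _]] := low_maximizer_next _ low1; last by lia.
    by move=> ?; apply: small; lia.
  split; last by exists 1, 1.
  move=> i; rewrite ltnS => ltip; have [|lt] := leqP i p; first exact: small.
  have -> : i = p.+1 by lia.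
  case: lown => _ _; rewrite /concave_bound => ->.
  by rewrite /c subSS subn0 !binn !M_small //.
have [bnd [j [k [lowj lowk jk]]]] := IH ln.
have [m [lowm km]] : exists m, low_maximizer n.+2 m /\ k <= m <= k.+1.
  by have [low|low] := low_maximizer_next bnd lowk; [exists k|exists k.+1]; split=> //; lia.
split; last by exists k, m.
move=> i; rewrite ltnS leq_eqVlt => /predU1P[[->]|]; last exact: bnd.
apply: (concave_bound_low lowj lowm); first by lia.
by apply: bnd; case: lowj => ? ? _; nia.
Qed.

Lemma concave_bounds i : concave_bound p i.
Proof.
have [|bnd _] := @low_maximizers (i + p.+2); first exact: leq_addl.
by apply: bnd; lia.
Qed.

Lemma M_increasing n : p.+2 <= n -> M p.+2 n < M p.+2 n.+1.
Proof.
move=> len; have [_ [k [_ [[k0 lkn ->] _ _]]]] := low_maximizers len.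
have kn : k <= n by nia.
apply: leq_trans (c_le_M (leqW kn)); rewrite /c subSn // binS.
rewrite mulnDr addnA -[X in X < _]addn0 ltn_add2l muln_gt0 k0 bin_gt0.
nia.
Qed.

(** A rise at [b] would propagate right to [d] or left to [a], depending on the side of the
    threshold. *)
Lemma falls_interval n a b d : 0 < a <= b -> b <= d < n ->
  c p.+2 n a.+1 < c p.+2 n a -> c p.+2 n d.+1 < c p.+2 n d ->
  c p.+2 n b.+1 < c p.+2 n b.
Proof.
move=> ab bd; rewrite !ltnNge => downa; apply: contra => up.
have [right|left] := leqP (2 * (n - b)) (p.+1 * b.+1).
  by apply: c_rise_right up; nia.
move/negP: downa; case; apply: (c_rise_left concave_bounds left ab _ up); lia.
Qed.

Lemma maximizesP n k : reflect (forall j, 0 < j < n -> c p.+2 n j <= c p.+2 n k)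
  (maximizes p.+2 n k).
Proof.
apply: (iffP allP) => H j; first by move=> jn; apply: H; rewrite mem_index_iota.
by rewrite mem_index_iota => /H.
Qed.

Lemma kn_max n k : 0 < k < n -> maximizes p.+2 n k -> k <= kn p.+2 n.
Proof.
move=> kn maxk; rewrite /kn.
by apply: (leq_bigmax_seq (F := id)) => //; rewrite mem_index_iota.
Qed.

Lemma knP n : 2 <= n -> 0 < kn p.+2 n < n /\ maximizes p.+2 n (kn p.+2 n).
Proof.
move=> n2; have [k [t [k0 t0 ekt eM]]] := @M_split p n n2.
have maxk : maximizes p.+2 n k.
  apply/maximizesP => j /andP[_ jn].
  rewrite (_ : c p.+2 n k = M p.+2 n) ?c_le_M // 1?ltnW // eM c_cc; last by lia.
  by congr (cc _ _ _); lia.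
(* 0 is the value of an empty maximum, excluded by the maximizer [k]. *)
have [|ne] := eqVneq (kn p.+2 n) 0.
  by have := @kn_max n k ltac:(lia) maxk; lia.
have : kn p.+2 n \in [seq k <- index_iota 1 n | maximizes p.+2 n k].
  move: ne; rewrite /kn -big_filter; elim: [seq _ <- _ | _] => [|x s IH].
    by rewrite big_nil.
  rewrite big_cons inE; case: (leqP x (\max_(j <- s) j)) => [|_]; last by rewrite eqxx.
  by move=> _ /IH ->; rewrite orbT.
by rewrite mem_filter mem_index_iota => /andP[].
Qed.
End Chain.

Lemma head_filter_iota (P : pred nat) x a d :
  let h := head x [seq i <- iota a d | P i] in
  (forall i, a <= i < a + d -> i < h -> ~~ P i) /\ (h = x \/ a <= h /\ P h).
Proof.
elim: d a => [|d IH] a /=; first by split; [lia | left].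
case: ifP => [Pa|nPa]; first by split=> [i|]; [move=> /= *; lia | right].
have [H1 H2] := IH a.+1; split=> [i ai ih|].
  by have [->|ne] := eqVneq i a; [rewrite nPa | apply: H1 => //; lia].
by case: H2 => [->|[lea Ph]]; [left | right; split=> //; lia].
Qed.

Theorem theorem6p3 (l n : nat) (hl : 2 <= l) (hn : 2 <= n) :
  (forall i : nat, 1 <= i -> i + 1 <= n - 1 ->
     i < kn l n -> c l n i <= c l n (i + 1))
  /\ (forall i : nat, 1 <= i -> i + 1 <= n - 1 ->
     kn l n <= i < ln l n -> c l n (i + 1) <= c l n i)
  /\ (forall i : nat, 1 <= i -> i + 1 <= n - 1 ->
     ln l n <= i -> c l n i <= c l n (i + 1)).
Proof.
case: l hl => [|[|p]] // _.
have [len|ltn] := leqP n p.+2.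
  have c0 i : i <= n -> c p.+2 n i = 0.
    move=> lein; apply/eqP; rewrite -leqn0 -(M_small len); exact: c_le_M.
  by split; [|split] => i _ lein _; rewrite !c0 //; lia.
have [/andP[k0 kn_lt] /maximizesP kmax] := knP p hn.
have [j [t [j0 t0 ejt eM]]] := @M_split p n hn.
have top : M p.+2 n <= c p.+2 n (kn p.+2 n).
  rewrite (_ : M p.+2 n = c p.+2 n j); first by apply: kmax; lia.
  by rewrite eM c_cc; [congr (cc _ _ _); lia | lia].
have maxk := @kn_max p n (kn p.+2 n).+1.
rewrite /ln; move: (kn p.+2 n) => k in k0 kn_lt kmax top maxk *.
(* At [k = n - 1] the value is [M p.+2 k], which is strictly below [M p.+2 n]. *)
have ltk1 : k.+1 < n.
  rewrite ltn_neqAle kn_lt andbT; apply/eqP => ek.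
  have := @M_increasing p k; rewrite ek => /(_ ltac:(lia)); rewrite ltnNge.
  by move: top; rewrite /c -ek subSnn bin_small // muln0 addn0 => ->.
(* Otherwise [k.+1] would be a larger maximizer. *)
have fallk : c p.+2 n k.+1 < c p.+2 n k.
  rewrite ltnNge; apply/negP => up.
  have : k.+1 <= k; last by rewrite ltnn.
  apply: maxk; first by lia.
  by apply/maximizesP => i /kmax lei; apply: leq_trans lei up.
have [before] := head_filter_iota (fun i => c p.+2 n i <= c p.+2 n i.+1) n.-1 k.+1 (n.-1 - k.+1).
rewrite -/(index_iota _ _); move: (head _ _) before => h before at_h.
split; [|split] => i i0; rewrite addn1 => lein.
- move=> ltik; rewrite leqNgt; apply/negP => falli.
  (* Falls at [i] and at [k] would force one at [k.-1], against the maximality of [k]. *)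
  have := @falls_interval p n i k.-1 k; rewrite prednK // => H.
  have : c p.+2 n k < c p.+2 n k.-1 by apply: H => //; lia.
  by rewrite ltnNge kmax //; lia.
- case/andP; rewrite leq_eqVlt => /predU1P[<- _|ltki ltil]; first exact: ltnW.
  by apply: ltnW; rewrite ltnNge; apply: before => //; lia.
(* The default [n.-1] exceeds every admissible [i]. Otherwise [h] is a rise, which cannot lie
   between the falls at [k] and [i]. *)
move=> leil; case: at_h => [eh|[lekh up]]; first by lia.
rewrite leqNgt; apply/negP => falli; move: up; rewrite leqNgt => /negP; apply.
by apply: (falls_interval _ _ fallk falli); lia.
Qed.
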